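(* Let $d\in\mathbb{N}$ be even, $\mathbf{s}=(s_1,\dots,s_d)\in\mathbb{N}^d$ and $\boldsymbol{\sigma}=(\sigma_1,\dots,\sigma_d)\in\{\pm1\}^d$. Then, in $\mathcal{A}$, $$T_{\mathcal{A}}(s_d,\dots,s_1;\sigma_d,\dots,\sigma_1)=(\sigma_1\cdots\sigma_d)^{(p-1-d)/2}\,(-1)^{s_1+\cdots+s_d}\,T_{\mathcal{A}}(s_1,\dots,s_d;\sigma_1,\dots,\sigma_d),$$ where $(\sigma_1\cdots\sigma_d)^{(p-1-d)/2}$ denotes the element $\big((\sigma_1\cdots\sigma_d)^{(p-1-d)/2}\ (\mathrm{mod}\ p)\big)_{3\le p\in\mathcal{P}}$ of $\mathcal{A}$.
   Context: $\mathbb{N}$ is the set of positive integers, $\mathcal{P}$ the set of primes, and $\mathcal{A}:=\prod_{p\in\mathcal{P}}(\mathbb{Z}/p\mathbb{Z})\big/\bigoplus_{p\in\mathcal{P}}(\mathbb{Z}/p\mathbb{Z})$, so that equality in $\mathcal{A}$ means equality of components for all but finitely many $p$. Finite alternating multiple $T$-values: for $\mathbf{s}\in\mathbb{N}^d$ and $\boldsymbol{\sigma}\in\{\pm1\}^d$, $$T_{\mathcal{A}}(\mathbf{s};\boldsymbol{\sigma}):=\Bigg(\sum_{\substack{p>n_1>\dots>n_d>0\\ n_j\equiv d-j+1\ (\mathrm{mod}\ 2)}}\ \prod_{j=1}^d\frac{\sigma_j^{(n_j-d+j-1)/2}}{n_j^{s_j}}\ (\mathrm{mod}\ p)\Bigg)_{p\in\mathcal{P}}\in\mathcal{A}.$$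 *)

(* Defs.v *)
From HB Require Import structures.
From mathcomp Require Import all_boot all_order all_algebra.
From mathcomp Require Import boolp classical_sets functions cardinality.

Set Implicit Arguments.
Unset Strict Implicit.
Unset Printing Implicit Defensive.

Import Order.TTheory GRing.Theory Num.Theory.
Local Open Scope ring_scope.

Definition primeT : Type := {p : nat | prime p}.

Definition prodFp : Type := forall p : primeT, 'F_(val p).

HB.instance Definition _ := Choice.copy prodFp (forall p : primeT, 'F_(val p)).

Section ProdRing.
Implicit Types x y z : prodFp.

Definition prod_zero : prodFp := fun=> 0.
Definition prod_one : prodFp := fun=> 1.
Definition prod_opp x : prodFp := fun p => - x p.
Definition prod_add x y : prodFp := fun p => x p + y p.
Definition prod_mul x y : prodFp := fun p => x p * y p.

Let addA : associative prod_add.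
Proof. by move=> x y z; apply/functional_extensionality_dep => p; apply: addrA. Qed.
Let addC : commutative prod_add.
Proof. by move=> x y; apply/functional_extensionality_dep => p; apply: addrC. Qed.
Let add0 : left_id prod_zero prod_add.
Proof. by move=> x; apply/functional_extensionality_dep => p; apply: add0r. Qed.
Let addN : left_inverse prod_zero prod_opp prod_add.
Proof. by move=> x; apply/functional_extensionality_dep => p; apply: addNr. Qed.

HB.instance Definition _ := GRing.isZmodule.Build prodFp addA addC add0 addN.

Let mulA : associative prod_mul.
Proof. by move=> x y z; apply/functional_extensionality_dep => p; apply: mulrA. Qed.
Let mulC : commutative prod_mul.
Proof. by move=> x y; apply/functional_extensionality_dep => p; apply: mulrC. Qed.
Let mul1 : left_id prod_one prod_mul.
Proof. by move=> x; apply/functional_extensionality_dep => p; apply: mul1r. Qed.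
Let mulD : left_distributive prod_mul +%R.
Proof. by move=> x y z; apply/functional_extensionality_dep => p; apply: mulrDl. Qed.
Let one_neq0 : prod_one != 0.
Proof.
apply/eqP => /(congr1 (fun x : prodFp => x (exist _ 2%N isT))) /eqP.
by rewrite oner_eq0.
Qed.

HB.instance Definition _ := GRing.Zmodule_isComNzRing.Build prodFp
  mulA mulC mul1 mulD one_neq0.

End ProdRing.

Definition dsumFp : {pred prodFp} :=
  fun x => `[< finite_set [set p : primeT | x p != 0] >].

Lemma dsumFpP (x : prodFp) :
  reflect (finite_set [set p : primeT | x p != 0]) (x \in dsumFp).
Proof. exact: asboolP. Qed.

Lemma dsumFp_idealr_closed : idealr_closed dsumFp.
Proof.
split.
- apply/dsumFpP; apply: (sub_finite_set _ (finite_set0 primeT)) => p.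
  by move=> /= /negP; apply; apply/eqP.
- apply/negP => /dsumFpP fin1.
  have {}fin1 : finite_set [set: primeT].
    by apply: sub_finite_set fin1 => p _ /=; exact: (oner_neq0 'F_(val p)).
  have /finite_seqP[X defX] := finite_image val fin1.
  have [q ltq prq] := prime_above (\max_(n <- X) n).
  have : range (val : primeT -> nat) q by exists (exist _ q prq).
  rewrite defX /= => Xq; move: ltq; rewrite ltnNge => /negP; apply.
  exact: leq_bigmax_seq Xq _.
- move=> a x y /dsumFpP finx /dsumFpP finy; apply/dsumFpP.
  apply: (@sub_finite_set _ _
    ([set p : primeT | x p != 0%R] `|` [set p : primeT | y p != 0%R])%classic);
    last by rewrite finite_setU.
  move=> p /= nz; apply/orP; move: nz; apply: contraR; rewrite negb_or !negbK.
  case/andP=> /eqP xp /eqP yp.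
  have -> : (a * x + y) p = a p * x p + y p by [].
  by rewrite xp yp mulr0 addr0.
Qed.

HB.instance Definition _ := isIdealr.Build prodFp dsumFp dsumFp_idealr_closed.

Definition ringA : comNzRingType := {ideal_quot dsumFp}.

Definition toA (x : prodFp) : ringA := (\pi_{ideal_quot dsumFp} x)%qT.

Lemma toA_eqP (x y : prodFp) :
  toA x = toA y <-> finite_set [set p : primeT | x p != y p].
Proof.
have -> : [set p : primeT | x p != y p]%classic =
    [set p : primeT | (x - y) p != 0%R]%classic.
  apply/predeqP => p /=.
  by have -> : (x - y) p = x p - y p by []; rewrite subr_eq0.
split=> [/eqP|fin].
  by rewrite /toA -Quotient.idealrBE => /dsumFpP.
by apply/eqP; rewrite /toA -Quotient.idealrBE; apply/dsumFpP.
Qed.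

(* The 0-based index [i : 'I_d] stands for j = i + 1, so that d - j + 1 is
   [d - i].  An admissible n satisfies [d - i <= n i], so that the truncated
   subtraction in [T_A_comp] is exact and the halving has no remainder. *)
Definition T_index (d p : nat) (n : {ffun 'I_d -> 'I_p}) : bool :=
  [&& [forall i : 'I_d, forall j : 'I_d, (i < j)%N ==> (n j < n i)%N],
      [forall i : 'I_d, (0 < n i)%N]
    & [forall i : 'I_d, (n i == d - i %[mod 2])%N]].

Definition T_A_comp (d : nat) (s : d.-tuple nat) (sigma : d.-tuple int)
    (p : nat) : 'F_p :=
  \sum_(n : {ffun 'I_d -> 'I_p} | T_index n) \prod_(i < d)
    ((tnth sigma i ^+ ((n i - (d - i)) %/ 2)%N)%:~R
       / (n i)%:R ^+ tnth s i).

Definition T_A (d : nat) (s : d.-tuple nat) (sigma : d.-tuple int) : ringA :=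
  toA (fun p : primeT => T_A_comp s sigma (val p)).

(* The exponent (p - 1 - d) / 2 is computed in [int], since it is negative for
   small p; when d is even it is exact for every odd p.  The component at
   p = 2, which is irrelevant in A, is set to 0. *)
Definition sign_A (d : nat) (e : int) : ringA :=
  toA (fun p : primeT =>
    if (3 <= val p)%N then (e ^ (((val p)%:Z - 1 - d%:Z) %/ 2)%Z)%:~R else 0).

(* Main.v *)
Require Import Defs.
From mathcomp Require Import all_boot all_order all_algebra.
From mathcomp Require Import classical_sets cardinality zify.

(** For odd [p], the substitution [n_j -> p - n_(d+1-j)] is an involution of the
    index set of the sum: it preserves the strict ordering, and the parity
    condition because [p] is odd and [d] even.  Modulo [p] it turns each
    denominator [n^s] into [(-1)^s n^s]; and writing [n_j = d - j + 1 + 2 h],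
    [p = 1 + d + 2 u], it replaces the exponent [h] of [sigma_j] by [u - h],
    which has the parity of [u + h]. *)

Import GRing.Theory.
Local Open Scope ring_scope.

Lemma tnth_rev_tuple (T : Type) (d : nat) (t : d.-tuple T) (i : 'I_d) :
  tnth (rev_tuple t) i = tnth t (rev_ord i).
Proof. by rewrite !(tnth_nth (tnth_default t i)) /= nth_rev size_tuple. Qed.

(** Induction on [d - i]: the last entry is positive, and strict decrease adds at least one at each
    step towards the front. This bound makes the truncated [n i - (d - i)] exact. *)
Lemma T_index_lb {d p : nat} {n : {ffun 'I_d -> 'I_p}} :
  T_index n -> forall i : 'I_d, (d - i <= n i)%N.
Proof.
case/and3P=> /forallP decr /forallP pos _ i.
have [k] := ubnP (d - i)%N; elim: k i => // k IH i lek.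
have [ltid|] := ltnP i.+1 d; last first.
  by move=> led; move: (pos i) (ltn_ord i); lia.
have /forallP/(_ (Ordinal ltid))/implyP/(_ (ltnSn i)) lt_n := decr i.
have IHi : (d - i.+1 <= n (Ordinal ltid))%N by apply: IH => /=; lia.
lia.
Qed.

Section Reflection.
Variables (d p : nat).
Hypothesis p_gt0 : (0 < p)%N.

(** The reduction modulo [p] only affects [0], which is sent to itself; the map is thus an
    involution of all of ['I_p], as reindexing requires. *)
Definition ord_opp (i : 'I_p) : 'I_p := Ordinal (ltn_pmod (p - i) p_gt0).

Lemma ord_opp_val (i : 'I_p) : (0 < i)%N -> ord_opp i = (p - i)%N :> nat.
Proof. by move=> i_gt0 /=; rewrite modn_small //; lia. Qed.

Lemma ord_oppK : involutive ord_opp.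
Proof.
move=> i; apply: ord_inj.
have [i_gt0|] := ltnP 0 i.
  by have lt_ip := ltn_ord i; rewrite !ord_opp_val //; lia.
by rewrite leqn0 => /eqP i0; rewrite /= i0 subn0 modnn subn0 modnn.
Qed.

Definition reflect_index (n : {ffun 'I_d -> 'I_p}) : {ffun 'I_d -> 'I_p} :=
  [ffun i => ord_opp (n (rev_ord i))].

Lemma reflect_indexK : involutive reflect_index.
Proof. by move=> n; apply/ffunP => i; rewrite !ffunE rev_ordK ord_oppK. Qed.

Hypotheses (p_odd : odd p) (d_even : ~~ odd d).

Lemma T_index_reflect (n : {ffun 'I_d -> 'I_p}) :
  T_index (reflect_index n) = T_index n.
Proof.
suff imp m : T_index m -> T_index (reflect_index m).
  by apply/idP/idP => /imp //; rewrite reflect_indexK.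
case/and3P=> /forallP decr /forallP pos /forallP par.
have val_refl i : reflect_index m i = (p - m (rev_ord i))%N :> nat.
  by rewrite ffunE ord_opp_val.
apply/and3P; split.
- apply/forallP => i; apply/forallP => j; apply/implyP => lt_ij.
  rewrite !val_refl.
  have /forallP/(_ (rev_ord i))/implyP lt_m := decr (rev_ord j).
  have {}lt_m : (m (rev_ord i) < m (rev_ord j))%N.
    by apply: lt_m => /=; have := ltn_ord j; lia.
  by have := ltn_ord (m (rev_ord j)); lia.
- by apply/forallP => i; rewrite val_refl; have := ltn_ord (m (rev_ord i)); lia.
(* The entry at [rev_ord i] is congruent to [i + 1]; as [p] is odd and [d] even, its reflection is
   congruent to [i], hence to [d - i]. *)
- apply/forallP => i; rewrite val_refl; have := par (rev_ord i).
  have := ltn_ord (m (rev_ord i)); have := ltn_ord i.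
  rewrite /= !modn2 => *; lia.
Qed.

End Reflection.

Lemma expr_pm1_parity (R : pzRingType) (x : R) (a b : nat) :
  x = 1 \/ x = -1 -> odd a = odd b -> x ^+ a = x ^+ b.
Proof.
case=> -> ab; first by rewrite !expr1n.
by rewrite -signr_odd ab signr_odd.
Qed.

Lemma natr_Fp_opp (p m : nat) : prime p -> (m <= p)%N ->
  (p - m)%:R = - m%:R :> 'F_p.
Proof.
by move=> p_pr le_mp; rewrite natrB // (pcharf0 (pchar_Fp p_pr)) sub0r.
Qed.

Lemma halved_exponentE (d p : nat) : (d < p)%N ->
  ((p%:Z - 1 - d%:Z) %/ 2)%Z = ((p - 1 - d) %/ 2)%N.
Proof. by move=> lt_dp; lia. Qed.

(** Here [i.+1] is [d - rev_ord i], the offset at the reflected position. The two lower bounds give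
    [h <= u], so the truncated difference is exactly [2 (u - h)]. *)
Lemma reflect_exponent_parity (d p i n : nat) :
  odd p -> ~~ odd d -> (i < d)%N -> (n < p)%N ->
  (d - i <= n)%N -> (i.+1 <= p - n)%N -> odd n = odd (d - i) ->
  odd ((p - n - i.+1) %/ 2) = odd ((p - 1 - d) %/ 2 + (n - (d - i)) %/ 2).
Proof. by move=> *; lia. Qed.

Lemma T_A_comp_rev (d : nat) (s : d.-tuple nat) (sigma : d.-tuple int)
    (p : nat) : (0 < d)%N -> ~~ odd d ->
  (forall i : 'I_d, tnth sigma i = 1 \/ tnth sigma i = -1) ->
  prime p -> (3 <= p)%N ->
  T_A_comp (rev_tuple s) (rev_tuple sigma) p =
    ((\prod_(i < d) tnth sigma i) ^ ((p%:Z - 1 - d%:Z) %/ 2)%Z)%:~R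
      * (-1) ^+ (\sum_(i < d) tnth s i)%N * T_A_comp s sigma p.
Proof.
move=> d_gt0 d_even sigma_pm1 p_pr p_ge3.
have p_odd : odd p by case: (even_prime p_pr) => // p2; rewrite p2 in p_ge3.
have p_gt0 := prime_gt0 p_pr.
rewrite /T_A_comp mulr_sumr.
rewrite (reindex_inj (inv_inj (@reflect_indexK d p p_gt0))) /=.
apply: eq_big => n; first by rewrite T_index_reflect.
rewrite T_index_reflect // => n_idx.
have lb := T_index_lb n_idx.
have lb' : forall i : 'I_d, (d - i <= reflect_index d p p_gt0 n i)%N.
  by apply: T_index_lb; rewrite T_index_reflect.
have /and3P[_ /forallP pos /forallP par] := n_idx.
(* The first entry of the admissible [n] lies between [d] and [p - 1]. For [p <= d] there is no such
   [n]: both sums are empty, and the possibly negative exponent does not matter. *)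
have lt_dp : (d < p)%N.
  have := leq_ltn_trans (lb (Ordinal d_gt0)) (ltn_ord _).
  by rewrite /= subn0.
rewrite halved_exponentE //; set u := ((p - 1 - d) %/ 2)%N.
(* Reversing the left product makes its [i]-th factor involve the [i]-th entries of [s], [sigma] and
   [n]; once the sign is distributed over the right product, the factors can be compared one by
   one. *)
rewrite (reindex_inj rev_ord_inj) /= -exprnP -prodrXl rmorph_prod /=.
rewrite -prodrXr -!big_split /=.
apply: eq_bigr => i _; rewrite !tnth_rev_tuple rev_ordK.
have := lb' (rev_ord i); rewrite ffunE rev_ordK ord_opp_val // => lb_i.
rewrite natr_Fp_opp //; last exact: ltnW.
rewrite (exprNn (n i)%:R) invfM invr_sign.
rewrite (@expr_pm1_parity _ _ _ (u + (n i - (d - i)) %/ 2) (sigma_pm1 i)).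
  by rewrite exprD intrM -!mulrA; congr (_ * _); rewrite mulrCA.
have rev_i : (d - (d - i.+1))%N = i.+1 by rewrite subKn.
rewrite rev_i; apply: reflect_exponent_parity => //; first by rewrite -rev_i.
by have := par i; rewrite !modn2; do 2!case: odd.
Qed.

Lemma toAM (x y : prodFp) : toA (x * y) = toA x * toA y.
Proof. exact: rmorphM. Qed.

Lemma toA_sign (k : nat) : toA ((-1) ^+ k) = (-1) ^+ k.
Proof. by rewrite /toA rmorphXn rmorphN1. Qed.

Lemma prodFp_signE (k : nat) (p : primeT) :
  ((-1) ^+ k : prodFp) p = (-1) ^+ k.
Proof.
elim: k => [|k IH] //; rewrite !exprS -IH.
by have -> : (-1 * (-1) ^+ k : prodFp) p = -1 * ((-1) ^+ k : prodFp) p by [].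
Qed.

Theorem proposition4p1 (d : nat) (s : d.-tuple nat) (sigma : d.-tuple int)
    (d_gt0 : (0 < d)%N) (d_even : ~~ odd d)
    (s_gt0 : forall i : 'I_d, (0 < tnth s i)%N)
    (sigma_pm1 : forall i : 'I_d, tnth sigma i = 1 \/ tnth sigma i = -1) :
  T_A (rev_tuple s) (rev_tuple sigma) =
    sign_A d (\prod_(i < d) tnth sigma i)
      * (-1) ^+ (\sum_(i < d) tnth s i)%N * T_A s sigma.
Proof.
rewrite /T_A /sign_A -toA_sign -!toAM; apply/toA_eqP.
(* The identity holds at every prime [p >= 3], so the components can differ only at [p = 2]. *)
apply: (@sub_finite_set _ _ [set exist _ 2%N isT : primeT]%classic);
  last exact: finite_set1.
move=> p /= neq_p; apply: val_inj => /=; apply/eqP; move: neq_p; apply: contraR.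
move=> p_neq2.
have p_ge3 : (3 <= val p)%N.
  by rewrite ltn_neqAle eq_sym p_neq2 (prime_gt1 (valP p)).
apply/eqP; rewrite (T_A_comp_rev _ _ _ _ d_gt0 d_even sigma_pm1 (valP p) p_ge3).
set a : prodFp := fun p => if _ then _ else _.
set b : prodFp := (-1) ^+ _; set c : prodFp := fun p => T_A_comp s _ _.
have -> : (a * b * c) p = a p * b p * c p by [].
by rewrite /a /b /c prodFp_signE p_ge3.
Qed.
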